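(* There is an infinite set $\mathcal{S}$ of positive integers $H$ with \[ \frac{\sigma(H)}{H}=(\log\log H)^{1/2}+O(\log\log\log H) \] such that for any residue system $C$ with $S(C)=\{d:\ d>1,\ d\mid H\}$ (each such divisor $d$ occurring exactly once), we have \[ \delta(C)\ge(1+o(1))\,\alpha(C), \] where $o(1)$ tends to $0$ as $H\to\infty$ through $\mathcal{S}$, uniformly in $C$. In particular, for all sufficiently large $H\in\mathcal{S}$, no such $C$ has $\delta(C)=0$.
   Context: $\sigma(H)$ is the sum of the positive divisors of $H$. A residue system is a finite set $C$ of ordered pairs of positive integers $(n,r)$, each interpreted as the residue class $r\pmod n$. $S(C)$ is the multiset of the moduli $n$ appearing in $C$ (with $n$ repeated once for each pair $(n,r)\in C$). $R(C)$ is the set of integers not congruent to $r\pmod n$ for any $(n,r)\in C$, and $\delta(C)$ is the asymptotic density of $R(C)$ (which exists, since $R(C)$ is a union of residue classes modulo the least common multiple of the moduli). Also $\alpha(C)=\prod_{n\in S(C)}(1-1/n)$. The constant implied by $O$ is absolute. *)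

(* Defs.v *)
From HB Require Export structures.
From mathcomp Require Export all_boot all_order all_algebra.
From mathcomp Require Export finmap multiset.
From mathcomp Require Export all_classical all_reals all_analysis.
Set Implicit Arguments.
Unset Strict Implicit.
Unset Printing Implicit Defensive.
Import Order.TTheory GRing.Theory Num.Theory.
Import numFieldNormedType.Exports.
Local Open Scope classical_set_scope.
Local Open Scope mset_scope.
Local Open Scope ring_scope.

Definition sigma (H : nat) : nat := (\sum_(d <- divisors H) d)%N.

(* A pair (n, r) stands for the residue class r mod n. *)
Definition is_residue_system (C : {fset nat * nat}) : Prop :=
  forall p, p \in C -> (0 < p.1)%N /\ (0 < p.2)%N.

Definition moduli (C : {fset nat * nat}) : {mset nat} :=
  seq_mset [seq p.1 | p <- enum_fset C].

Definition divisors_gt1 (H : nat) : {mset nat} :=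
  seq_mset [seq d <- divisors H | (1 < d)%N].

Definition uncovered (C : {fset nat * nat}) : set int :=
  [set m : int | forall p, p \in C -> ~ (m = p.2%:Z %[mod p.1%:Z])%Z].

(* Two-sided density: the limiting proportion of A in {-N, ..., N}.  [lim] is
   total, but for unions of residue classes the limit exists. *)
Definition density (R : realType) (A : set int) : R :=
  lim (((\sum_(i < N.*2.+1) \1_A (i%:Z - N%:Z)) / N.*2.+1%:R : R) @[N --> \oo]).

Definition delta (R : realType) (C : {fset nat * nat}) : R :=
  density R (uncovered C).

Definition alpha (R : realType) (C : {fset nat * nat}) : R :=
  \prod_(n <- moduli C) (1 - n%:R^-1).

(* Main.v *)
(* A class mod n meets the set left uncovered by classes with moduli coprime to
   n in proportion exactly 1/n.  Adding the classes one at a time gives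
   delta >= alpha - beta, where beta sums 1/(n n') over the pairs of moduli that
   are not coprime.  Put s = sigma(H)/H.  For the divisors of H this reads
   alpha >= exp(-s) and beta <= s^2 sum_(p | H) p^-2 <= 2 s^2 / pdiv H, so it is
   enough that pdiv H be much larger than s^2 exp(s).

   Such H with s close to sqrt(log log H) are powers P^k, where P is the product
   of the primes in (2^J, m]: by Mertens (only a lower bound for the sum of 1/p
   is needed) some m <= 2^L with L = J^2 log 2 + O(J) makes the Euler product
   equal to J log 2 - 3 log J up to O(1), and k, which hardly affects s, then
   adjusts log H to 2^L up to a bounded factor. *)
Require Import Defs.
From mathcomp Require Import ring lra zify.
Set Implicit Arguments.
Unset Strict Implicit.
Unset Printing Implicit Defensive.
Import Order.TTheory GRing.Theory Num.Theory.
Import numFieldNormedType.Exports.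
Local Open Scope classical_set_scope.
Local Open Scope ring_scope.

(** * Averages over a period, and densities of periodic sets *)

Section PeriodicAverage.
Variables (R : realType) (M : nat).

Definition avg (f : int -> R) : R := (\sum_(i < M) f i%:Z) / M%:R.

Definition periodic (f : int -> R) := forall m, f (m + M%:Z) = f m.

(** Shifting by 1 only trades the first term for an equal one at the end; integer induction on the
    shift does the rest. *)
Lemma sum_shift_periodic (f : int -> R) (a : int) : periodic f ->
  \sum_(i < M) f (i%:Z + a) = \sum_(i < M) f i%:Z.
Proof.
move=> fP.
have step (b : int) :
    \sum_(i < M) f (i%:Z + (b + 1)) = \sum_(i < M) f (i%:Z + b).
  move: fP; rewrite /periodic; case: M => [|N] fP; first by rewrite !big_ord0.
  rewrite big_ord_recr [RHS]big_ord_recl /= addrC; congr (_ + _).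
    have -> : N%:Z + (b + 1) = 0%:Z + b + N.+1%:Z by lia.
    by rewrite fP.
  by apply: eq_bigr => i _; congr f; rewrite /bump /=; lia.
have -> : \sum_(i < M) f i%:Z = \sum_(i < M) f (i%:Z + 0).
  by apply: eq_bigr => i _; rewrite addr0.
elim/int_ind: a => [//|n <-|n <-].
  by rewrite -[RHS]step; apply: eq_bigr => i _; congr f; lia.
by rewrite -[LHS]step; apply: eq_bigr => i _; congr f; lia.
Qed.

Lemma avg_shift (f : int -> R) (a : int) : periodic f ->
  avg (fun m => f (m + a)) = avg f.
Proof. by move=> fP; rewrite /avg sum_shift_periodic. Qed.

Lemma ler_avg (f g : int -> R) : (forall m, f m <= g m) -> avg f <= avg g.
Proof.
move=> fg; rewrite ler_wpM2r ?invr_ge0 //; apply: ler_sum => i _; exact: fg.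
Qed.

Lemma avgD (f g : int -> R) : avg (fun m => f m + g m) = avg f + avg g.
Proof. by rewrite /avg big_split mulrDl. Qed.

Lemma avgB (f g : int -> R) : avg (fun m => f m - g m) = avg f - avg g.
Proof. by rewrite /avg sumrB mulrBl. Qed.

Lemma avg_sum (I : Type) (s : seq I) (f : I -> int -> R) :
  avg (fun m => \sum_(i <- s) f i m) = \sum_(i <- s) avg (f i).
Proof. by rewrite /avg exchange_big mulr_suml. Qed.

Lemma eq_avg (f g : int -> R) : f =1 g -> avg f = avg g.
Proof. by move=> /funext ->. Qed.

Hypothesis M_gt0 : (0 < M)%N.

Lemma avg_cst (a : R) : avg (fun=> a) = a.
Proof.
rewrite /avg sumr_const card_ord -(mulr_natr a) mulfK //.
by rewrite pnatr_eq0 -lt0n.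
Qed.

(** Whole periods contribute their average exactly. In the remainder of [r < M] terms both the sum
    and [r * avg f] lie between 0 and [r]. *)
Lemma periodic_sum_avg (f : int -> R) (n : nat) (a : int) : periodic f ->
  (forall m, 0 <= f m <= 1) ->
  `|\sum_(i < n) f (i%:Z + a) - n%:R * avg f| <= M%:R.
Proof.
move=> fP f01.
rewrite (divn_eq n M); elim: (n %/ M)%N => [|q IH].
  rewrite mul0n add0n; set r := (n %% M)%N.
  have rM : (r <= M)%N by rewrite ltnW // ltn_mod.
  have a01 : 0 <= avg f <= 1.
    have [a0 a1] := (avg_cst 0, avg_cst 1).
    by apply/andP; split; [rewrite -a0 | rewrite -a1];
      apply: ler_avg => m; case/andP: (f01 m).
  have s01 : 0 <= \sum_(i < r) f (i%:Z + a) <= r%:R.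
    rewrite sumr_ge0 => [|i _]; last by case/andP: (f01 (i%:Z + a)).
    have -> : r%:R = \sum_(i < r) (1 : R) by rewrite sumr_const card_ord.
    apply: ler_sum => i _.
    by case/andP: (f01 (i%:Z + a)).
  have rM' : (r%:R : R) <= M%:R by rewrite ler_nat.
  have r0 : 0 <= (r%:R : R) by [].
  move: a01 s01 rM' r0; set A := avg f; set B := bigop _ _ _.
  move: (r%:R : R) (M%:R : R) => x y; move=> /andP[A0 A1] /andP[B0 B1] xy x0.
  by rewrite ler_norml; apply/andP; split; nra.
rewrite mulSn -addnA big_split_ord /= sum_shift_periodic //.
have -> : \sum_(i < q * M + n %% M) f ((M + i)%N%:Z + a) =
    \sum_(i < q * M + n %% M) f (i%:Z + a).
  by apply: eq_bigr => i _; rewrite -[RHS]fP; congr f; lia.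
rewrite natrD mulrDl; set s := \sum_(i < M) _.
have -> : M%:R * avg f = s.
  by rewrite /avg mulrC divfK // pnatr_eq0 -lt0n.
by rewrite addrC addrKA.
Qed.

Lemma density_periodic (A : set int) :
  (forall m, (m + M%:Z) \in A = (m \in A)) -> density R A = avg (\1_A).
Proof.
move=> AP; apply/cvg_lim => //.
have fP : periodic (\1_A : int -> R) by move=> m; rewrite !indicE AP.
have f01 m : 0 <= (\1_A m : R) <= 1.
  by rewrite indicE; case: (m \in A) => /=; rewrite ?lexx ?ler01.
apply/cvgrPdist_le => e e0; near=> N.
have N0 : 0 < (N.*2.+1%:R : R) by rewrite ltr0n.
(* The window {-N, ..., N} is [2 N + 1] terms starting at [- N], so the error in the proportion is
   at most [M / (2 N + 1)]. *)
have := @periodic_sum_avg (\1_A) N.*2.+1 (- N%:Z) fP f01.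
set s := \sum_(i < _) _.
rewrite -(ler_pM2r (_ : 0 < (N.*2.+1%:R : R)^-1)) ?invr_gt0 //.
have -> : avg \1_A - s / N.*2.+1%:R = - ((s - N.*2.+1%:R * avg \1_A) / N.*2.+1%:R).
  move: (N.*2.+1%:R : R) N0 => x x0.
  by field; rewrite gt_eqF.
rewrite normrN normrM (ger0_norm (_ : 0 <= (N.*2.+1%:R)^-1)) ?invr_ge0 //.
move/le_trans; apply.
rewrite ler_pdivrMr // mulrC -ler_pdivrMr //.
have : M%:R / e <= N%:R by near: N; exact: nbhs_infty_ger.
move/le_trans; apply; rewrite ler_nat -addnn; lia.
Unshelve. all: by end_near. Qed.

End PeriodicAverage.

(** * Sieving by residue classes one at a time *)

Section Sieve.
Variable R : realType.
Implicit Types (p q : nat * nat) (l : seq (nat * nat)) (m : int).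

Definition hit p m : bool := (m == p.2%:Z %[mod p.1%:Z])%Z.

Definition sifted l m : bool := all (fun p => ~~ hit p m) l.

Definition hitR p m : R := (hit p m)%:R.

Definition siftedR l m : R := (sifted l m)%:R.

Lemma hit_shift p m a : (p.1%:Z %| a)%Z -> hit p (m + a) = hit p m.
Proof.
move=> pa; rewrite /hit !eqz_mod_dvd.
have -> : m + a - p.2%:Z = a + (m - p.2%:Z) by lia.
by rewrite rpredDl.
Qed.

Lemma sifted_shift l m a : (forall p, p \in l -> (p.1%:Z %| a)%Z) ->
  sifted l (m + a) = sifted l m.
Proof. by move=> la; apply: eq_in_all => p pl; rewrite hit_shift // la. Qed.

Lemma sum_hitR p : (0 < p.1)%N -> \sum_(i < p.1) hitR p i%:Z = 1.
Proof.
case: p => -[//|n] r _ /=.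
rewrite (bigD1 (inord (r %% n.+1))) //= /hitR /hit /= !modz_nat eqz_nat.
rewrite inordK ?ltn_mod // modn_mod eqxx big1 ?addr0 // => i ir.
rewrite !modz_nat eqz_nat (modn_small (ltn_ord i)).
apply: contraNeq ir; rewrite pnatr_eq0 eqb0 negbK => /eqP ir.
by apply/eqP/val_inj; rewrite /= inordK ?ltn_mod.
Qed.

(** Multiplication by [Q] permutes the residues mod [p.1] (the map [phi]), so the progression meets
    the class exactly once. *)
Lemma sum_hitR_progression p m (Q : nat) : (0 < p.1)%N -> coprime Q p.1 ->
  \sum_(k < p.1) hitR p (m + (k * Q)%N%:Z) = 1.
Proof.
case: p => -[//|n] r _ /= Qn; rewrite -(@sum_hitR (n.+1, r)) //=.
rewrite -(@sum_shift_periodic _ n.+1 _ m); last first.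
  by move=> a; rewrite /hitR hit_shift /= ?dvdzz.
pose phi (k : 'I_n.+1) : 'I_n.+1 := inord ((k * Q) %% n.+1).
have phiE k : phi k = (k * Q %% n.+1)%N :> nat by rewrite inordK ?ltn_mod.
have phi_inj : injective phi.
  move=> i j /(congr1 val) /=; rewrite !phiE => ij; apply: val_inj => /=.
  wlog le_ij : i j ij / (i <= j)%N => [hw|].
    by case/orP: (leq_total i j) => h; [exact: hw | apply/esym/hw].
  move/eqP: ij; rewrite eq_sym eqn_mod_dvd ?leq_mul // -mulnBl.
  rewrite Gauss_dvdl 1?coprime_sym // => /dvdn_leq; have := ltn_ord j; lia.
rewrite [RHS](reindex_inj phi_inj) /=; apply: eq_bigr => k _.
rewrite phiE /hitR; congr (_%:R).
set a := (k * Q %/ n.+1)%N; set b := (k * Q %% n.+1)%N.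
have -> : m + (k * Q)%N%:Z = (b%:Z + m) + (a * n.+1)%N%:Z.
  by rewrite [X in X%:Z](divn_eq (k * Q) n.+1) -/a -/b; lia.
by rewrite hit_shift //= PoszM dvdz_mull.
Qed.

Variable M : nat.
Hypothesis M_gt0 : (0 < M)%N.

(** Sum the shifts of [hitR p * g] by [0, Q, ..., (p.1 - 1) Q]: each has the same average, [g] is
    unchanged by them, and the hits add up to 1. *)
Lemma avg_hit_indep p (g : int -> R) (Q : nat) : (p.1 %| M)%N ->
  coprime Q p.1 -> periodic M g -> (forall m, g (m + Q%:Z) = g m) ->
  avg M (fun m => hitR p m * g m) = (p.1%:R)^-1 * avg M g.
Proof.
move=> pM Qp gM gQ.
have p_gt0 : (0 < p.1)%N := dvdn_gt0 M_gt0 pM.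
have gkQ (k : nat) m : g (m + (k * Q)%N%:Z) = g m.
  elim: k => [|k IH]; first by rewrite mul0n addr0.
  by rewrite -IH -[RHS]gQ; congr g; lia.
apply: (@mulfI _ p.1%:R); first by rewrite pnatr_eq0 -lt0n.
rewrite mulVKf; last by rewrite pnatr_eq0 -lt0n.
have -> : avg M g =
    avg M (fun m => \sum_(k < p.1) hitR p (m + (k * Q)%N%:Z) * g (m + (k * Q)%N%:Z)).
  apply: eq_avg => m; under eq_bigr => k _ do rewrite gkQ.
  by rewrite -mulr_suml sum_hitR_progression // mul1r.
rewrite avg_sum; under eq_bigr => k _.
  rewrite (@avg_shift _ _ (fun m => hitR p m * g m)); last first.
    by move=> m; rewrite gM /hitR hit_shift // dvdzE.
  over.
by rewrite sumr_const card_ord mulr_natl.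
Qed.

Lemma avg_hitR p : (p.1 %| M)%N -> avg M (hitR p) = (p.1%:R)^-1.
Proof.
move=> pM; have := @avg_hit_indep p (fun=> 1) 1 pM.
rewrite avg_cst // mulr1 => <- //; first by apply: eq_avg => m; rewrite mulr1.
by rewrite coprime1n.
Qed.

Lemma siftedR_periodic l : all (fun p => p.1 %| M)%N l -> periodic M (siftedR l).
Proof.
by move=> /allP lM m; rewrite /siftedR sifted_shift // => p /lM.
Qed.

Lemma siftedR_cons p l m :
  siftedR (p :: l) m = siftedR l m - hitR p m * siftedR l m.
Proof.
rewrite /siftedR /= /hitR; case: (hit p m); first by rewrite mul1r subrr.
by rewrite mul0r subr0.
Qed.

(** Dropping classes from the sieve can only enlarge the sifted set, and by no more than the union
    of the dropped classes. *)
Lemma siftedR_filter l (P : pred (nat * nat)) m :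
  siftedR l m <= siftedR [seq q <- l | P q] m <=
    siftedR l m + \sum_(q <- l | ~~ P q) hitR q m.
Proof.
elim: l => [|q l /andP[IH1 IH2]]; first by rewrite big_nil addr0 lexx.
have s0 l' : 0 <= siftedR l' m <= 1.
  by rewrite /siftedR; case: sifted; rewrite ?lexx ?ler01.
have h0 : 0 <= \sum_(q <- l | ~~ P q) hitR q m by apply: sumr_ge0.
have := s0 l; have := s0 [seq q <- l | P q]; move: h0 IH1 IH2.
rewrite big_cons /= siftedR_cons /hitR; case: (P q) => /=; last first.
  by case: hit => /=; rewrite ?mul0r ?mul1r ?add0r; set S := bigop _ _ _; lra.
rewrite siftedR_cons /hitR.
by case: hit => /=; rewrite ?mul0r ?mul1r ?add0r; set S := bigop _ _ _; lra.
Qed.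

(** Drop the moduli not coprime to [p.1]. The rest of the sieve is periodic modulo the product of
    its moduli, which is coprime to [p.1], hence independent of the class [p]; the union bound then
    restores the dropped classes. *)
Lemma avg_hit_sifted p l : (p.1 %| M)%N -> all (fun q => q.1 %| M)%N l ->
  avg M (fun m => hitR p m * siftedR l m) <=
  (p.1%:R)^-1 * (avg M (siftedR l) +
                 \sum_(q <- l | ~~ coprime q.1 p.1) (q.1%:R)^-1).
Proof.
move=> pM lM; pose l' := [seq q <- l | coprime q.1 p.1].
have l'M : all (fun q => q.1 %| M)%N l' 
  by rewrite all_filter; apply: sub_all lM => q qM; apply/implyP.
apply: (@le_trans _ _ (avg M (fun m => hitR p m * siftedR l' m))).
  apply: ler_avg => m; apply: ler_wpM2l => //.
  by case/andP: (siftedR_filter l (fun q => coprime q.1 p.1) m).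
rewrite (@avg_hit_indep _ _ (\prod_(q <- l') q.1)%N) //; first last.
- move=> m; rewrite /siftedR sifted_shift // => q ql'.
  by rewrite dvdzE /= (big_rem q) //= dvdn_mulr.
- exact: siftedR_periodic.
- rewrite big_filter; apply: (big_ind (fun n => coprime n p.1)) => //.
    by rewrite coprime1n.
  by move=> x y xp yp; rewrite coprimeMl xp.
apply: ler_wpM2l; first by rewrite invr_ge0.
have -> : \sum_(q <- l | ~~ coprime q.1 p.1) (q.1%:R)^-1 =
   avg M (fun m => \sum_(q <- l | ~~ coprime q.1 p.1) hitR q m).
  rewrite -big_filter; under [in RHS]eq_avg => m do rewrite -big_filter.
  rewrite avg_sum big_seq [RHS]big_seq; apply: eq_bigr => q.
  by rewrite mem_filter => /andP[_ /(allP lM) qM]; rewrite avg_hitR.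
rewrite -avgD; apply: ler_avg => m.
by case/andP: (siftedR_filter l (fun q => coprime q.1 p.1) m).
Qed.

(** With [x = 1 / p.1], adding [p] multiplies the average by at least [1 - x], up to a loss [x]
    times the sum over non-coprime moduli. The factor [1 - x] also hits the accumulated error, which
    only helps since that error is nonnegative ([H3]). [H1] and [H2] bound the new double sum below
    by the part that the induction produces. *)
Lemma avg_sifted_ge l : all (fun p => p.1 %| M)%N l ->
  \prod_(p <- l) (1 - (p.1%:R)^-1) -
  \sum_(p <- l) \sum_(q <- l | ~~ coprime q.1 p.1) (p.1%:R)^-1 * (q.1%:R)^-1
  <= avg M (siftedR l).
Proof.
elim: l => [_|p l IH /= /andP[pM lM]].
  by rewrite !big_nil subr0 (_ : siftedR [::] = fun=> 1) ?avg_cst.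
have -> : avg M (siftedR (p :: l)) =
    avg M (siftedR l) - avg M (fun m => hitR p m * siftedR l m).
  by rewrite -avgB; apply: eq_avg => m; rewrite siftedR_cons.
have := avg_hit_sifted pM lM; have := IH lM.
have p_gt0 : (0 < p.1)%N := dvdn_gt0 M_gt0 pM.
have pV0 : 0 <= (p.1%:R : R)^-1 by rewrite invr_ge0.
have pV1 : (p.1%:R : R)^-1 <= 1 by rewrite invf_le1 ?ler1n ?ltr0n.
rewrite !big_cons.
have H1 : \sum_(q <- l) \sum_(r <- p :: l | ~~ coprime r.1 q.1)
     ((q.1%:R)^-1 * (r.1%:R)^-1 : R) >=
  \sum_(q <- l) \sum_(r <- l | ~~ coprime r.1 q.1) ((q.1%:R)^-1 * (r.1%:R)^-1).
  apply: ler_sum => q _; rewrite big_cons; case: ifP => // _.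
  by rewrite lerDr mulr_ge0 ?invr_ge0.
have H2 : (if ~~ coprime p.1 p.1
     then (p.1%:R)^-1 * (p.1%:R)^-1 +
          \sum_(j <- l | ~~ coprime j.1 p.1) (p.1%:R)^-1 * (j.1%:R)^-1
     else \sum_(j <- l | ~~ coprime j.1 p.1) (p.1%:R)^-1 * (j.1%:R)^-1) >=
   (p.1%:R)^-1 * \sum_(j <- l | ~~ coprime j.1 p.1) (j.1%:R : R)^-1.
  rewrite mulr_sumr; case: ifP => // _.
  by rewrite lerDr mulr_ge0.
have H3 : 0 <= \sum_(q <- l) \sum_(r <- l | ~~ coprime r.1 q.1)
    ((q.1%:R)^-1 * (r.1%:R)^-1 : R).
  by apply: sumr_ge0 => q _; apply: sumr_ge0 => r _; rewrite mulr_ge0 ?invr_ge0.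
move: H1 H2 H3; move: (bigop _ _ _) => B1.
move: (bigop _ _ _) => B2; move: (if _ then _ else _) => B3.
move: (bigop _ _ _) => B4; move: (bigop _ _ _) => B5.
move: (avg _ _) => D1; move: (avg _ _) => D2.
move: pV0 pV1; move: (p.1%:R^-1 : R) => x.
nra.
Qed.

End Sieve.

(** * Sums over divisors, and the resulting lower bound for [delta] *)

Section Abundancy.
Variable R : realType.

Definition abundancy (H : nat) : R := (sigma H)%:R / H%:R.

(** The map [d |-> H / d] permutes the divisors. *)
Lemma abundancyE H : (0 < H)%N ->
  abundancy H = \sum_(d <- divisors H) (d%:R)^-1.
Proof.
move=> H_gt0.
have divK d : d \in divisors H -> (H %/ d * d = H)%N.
  by rewrite -dvdn_divisors // => /divnK.
have permH : perm_eq (divisors H) [seq H %/ d | d <- divisors H]%N.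
  apply: uniq_perm; rewrite ?divisors_uniq //.
    rewrite map_inj_in_uniq ?divisors_uniq // => d d' dH d'H e.
    have d_gt0 : (0 < H %/ d)%N.
      by move: (divK d dH); case: (H %/ d)%N => // h; move: H_gt0; rewrite -h.
    by apply/eqP; rewrite -(eqn_pmul2l d_gt0) divK // e divK.
  move=> d; apply/idP/mapP => [dH|[d' d'H ->]].
    have h := divK d dH; exists (H %/ d)%N.
      by rewrite -dvdn_divisors // -{2}h dvdn_mulr.
    rewrite -{1}h mulKn //.
    by move: h; case: (H %/ d)%N => // h; move: H_gt0; rewrite -h.
  by rewrite -dvdn_divisors // -{2}(divK d' d'H) dvdn_mulr.
rewrite (perm_big _ permH) big_map /= /abundancy /sigma natr_sum mulr_suml.
rewrite big_seq [RHS]big_seq; apply: eq_bigr => d dH.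
have := divK d dH; move: (H %/ d)%N => h hd; move: H_gt0.
rewrite -hd muln_gt0 => /andP[h0 d0]; rewrite natrM.
by field; rewrite !pnatr_eq0 -!lt0n h0.
Qed.

Lemma abundancy_ge1 H : (0 < H)%N -> 1 <= abundancy H.
Proof.
move=> H_gt0; rewrite abundancyE // (big_rem 1%N) /=; last first.
  by rewrite -dvdn_divisors.
by rewrite invr1 lerDl sumr_ge0 // => d _; rewrite invr_ge0.
Qed.

Lemma ler_sum_subset (I : eqType) (s s' : seq I) (F : I -> R) :
  uniq s -> uniq s' -> {subset s <= s'} -> (forall i, 0 <= F i) ->
  \sum_(i <- s) F i <= \sum_(i <- s') F i.
Proof.
move=> su s'u ss' F0.
have /(perm_big _) -> : perm_eq s' (s ++ [seq i <- s' | i \notin s]).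
  apply: uniq_perm => //.
    rewrite cat_uniq su filter_uniq // andbT.
    by apply/hasPn => i; rewrite mem_filter => /andP[].
  move=> i; rewrite mem_cat mem_filter; case: (boolP (i \in s)) => [/ss' ->|] //.
by rewrite big_cat lerDl sumr_ge0.
Qed.

(* [1/(n(n-1))] telescopes. *)
Lemma sum_inv_mul_pred_le (a : nat) (l : seq nat) : (0 < a)%N -> uniq l ->
  {in l, forall n, (a < n)%N} ->
  \sum_(n <- l) (n%:R * (n%:R - 1))^-1 <= (a%:R : R)^-1.
Proof.
move=> a_gt0 lu la.
pose b := (\max_(n <- l) n)%N.
have F0 (n : nat) : 0 <= (n%:R * (n%:R - 1) : R)^-1.
  rewrite invr_ge0; case: n => [|n]; first by rewrite mul0r.
  by rewrite mulr_ge0 // subr_ge0 ler1n.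
apply: (@le_trans _ _ (\sum_(a.+1 <= n < (maxn a b).+1) (n%:R * (n%:R - 1))^-1)).
  apply: ler_sum_subset => //; first by rewrite iota_uniq.
  move=> n nl; rewrite mem_index_iota la //= ltnS leq_max.
  by rewrite /b [X in _ || X](leq_bigmax_seq _ nl) // orbT.
have am : (a <= maxn a b)%N by rewrite leq_maxl.
elim: (maxn a b) am => [|c IH].
  by rewrite leqn0 => /eqP a0; rewrite a0 in a_gt0.
rewrite leq_eqVlt => /predU1P[<-|ac].
  by rewrite big_geq // invr_ge0.
suff : \sum_(a.+1 <= n < c.+2) (n%:R * (n%:R - 1) : R)^-1 = a%:R^-1 - c.+1%:R^-1.
  by move=> ->; rewrite gerBl invr_ge0.
rewrite (eq_big_nat _ _ (F2 := fun n => n.-1%:R^-1 - n%:R^-1)).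
  under eq_big_nat => n _ do rewrite -opprB.
  rewrite sumrN (@telescope_sumr _ a.+1 c.+2 (fun n => n.-1%:R^-1)) //; last lia.
  by rewrite opprB.
move=> n /andP[an _]; case: n an => // n an.
have n0 : (0 < (n%:R : R)) by rewrite ltr0n; lia.
rewrite -natr1 /=; move: (n%:R : R) n0 => x x0.
by field; rewrite !gt_eqF //; lra.
Qed.

(** [1 - 1/d = 1 / (1 + 1/(d-1)) >= exp (- 1/(d-1))]. Replacing [1/(d-1)] by [1/d] costs
    [1/(d(d-1))], in total at most 1, which is the term of the divisor 1 in [abundancy H]. *)
Lemma prod_one_sub_inv_ge H : (0 < H)%N ->
  expR (- abundancy H) <= \prod_(d <- divisors H | (1 < d)%N) (1 - (d%:R)^-1).
Proof.
move=> H_gt0.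
have sumE : \sum_(d <- divisors H | (1 < d)%N) (d%:R - 1 : R)^-1 <= abundancy H.
  have -> : abundancy H = 1 + \sum_(d <- divisors H | (1 < d)%N) (d%:R)^-1.
    rewrite abundancyE // (bigID (fun d => 1 < d)%N) /= addrC; congr (_ + _).
    rewrite -big_filter; set l := [seq _ <- _ | _].
    suff -> : l = [:: 1%N] by rewrite big_seq1 invr1.
    apply: perm_small_eq => //; apply: uniq_perm => //.
      by rewrite filter_uniq ?divisors_uniq.
    move=> d; rewrite mem_filter -dvdn_divisors // inE -leqNgt.
    case: d => [|[|d]]; [|by rewrite dvd1n|by []].
    by rewrite dvd0n (gtn_eqF H_gt0).
  have h : \sum_(d <- divisors H | (1 < d)%N) (d%:R * (d%:R - 1) : R)^-1 <= 1.
    rewrite -big_filter; apply: le_trans (sum_inv_mul_pred_le (a := 1) _ _ _) _ => //.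
    - by rewrite filter_uniq ?divisors_uniq.
    - by move=> d; rewrite mem_filter => /andP[].
    - by rewrite invr1.
  have -> : \sum_(d <- divisors H | (1 < d)%N) (d%:R - 1 : R)^-1 =
    \sum_(d <- divisors H | (1 < d)%N) (d%:R * (d%:R - 1))^-1 +
    \sum_(d <- divisors H | (1 < d)%N) (d%:R)^-1.
    rewrite -big_split; apply: eq_bigr => d d1 /=.
    have : 1 < (d%:R : R) by rewrite ltr1n.
    move: (d%:R : R) => x x1; field; rewrite !gt_eqF //; lra.
  by rewrite lerD2r.
apply: (@le_trans _ _
    (expR (- \sum_(d <- divisors H | (1 < d)%N) (d%:R - 1 : R)^-1))).
  by rewrite ler_expR lerN2.
rewrite -sumrN expR_sum; apply: ler_prod => d d1.
rewrite expR_ge0 /= expRN.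
have d1' : 1 < (d%:R : R) by rewrite ltr1n.
have := expR_ge1Dx (d%:R - 1 : R)^-1.
move: (d%:R : R) d1' => x x1 hx.
have -> : 1 - x^-1 = (1 + (x - 1)^-1)^-1 by field; rewrite !gt_eqF //; lra.
by rewrite lef_pV2 ?posrE ?expR_gt0 // addr_gt0 ?invr_gt0 ?subr_gt0.
Qed.

(** Division by [p] injects the divisors that are multiples of [p] into all divisors. *)
Lemma sum_inv_multiples H p : (0 < H)%N -> p \in primes H ->
  \sum_(d <- divisors H | (p %| d)%N) (d%:R)^-1 <= (p%:R)^-1 * abundancy H.
Proof.
move=> H_gt0; rewrite mem_primes => /and3P[p_pr _ pH].
have p_gt0 := prime_gt0 p_pr.
have divH_gt0 d : d \in divisors H -> (0 < d)%N.
  by rewrite -dvdn_divisors //; apply: dvdn_gt0.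
rewrite abundancyE // mulr_sumr.
have -> : \sum_(d <- divisors H | (p %| d)%N) (d%:R : R)^-1 =
    \sum_(e <- [seq d %/ p | d <- divisors H & (p %| d)]%N) (p%:R)^-1 * (e%:R)^-1.
  rewrite big_map big_filter; apply: eq_bigr => d pd.
  by rewrite -invfM -natrM mulnC divnK.
apply: ler_sum_subset.
- rewrite map_inj_in_uniq ?filter_uniq ?divisors_uniq // => d d'.
  rewrite !mem_filter => /andP[pd _] /andP[pd' _] e.
  by rewrite -(divnK pd) e divnK.
- exact: divisors_uniq.
- move=> e /mapP[d]; rewrite mem_filter -dvdn_divisors // => /andP[pd dH] ->.
  rewrite -dvdn_divisors //; apply: (dvdn_trans _ dH).
  by rewrite -{2}(divnK pd) dvdn_mulr.
- by move=> i; rewrite mulr_ge0 ?invr_ge0.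
Qed.

(** Since [p^-2 <= 1/(p(p-1))], telescoping from [pdiv H - 1] gives [1/(pdiv H - 1) <= 2/pdiv H];
    for [H = 1] the sum is empty. *)
Lemma sum_inv_sqr_primes_le H : (0 < H)%N ->
  \sum_(p <- primes H) (p%:R ^- 2) <= 2 / (pdiv H)%:R :> R.
Proof.
case: H => [//|[|H]] _; first by rewrite big_nil.
set n := H.+2; have n1 : (1 < n)%N by [].
have pd := pdiv_prime n1; have pd1 := prime_gt1 pd.
have pminP : {in primes n, forall p, ((pdiv n).-1 < p)%N}.
  move=> p; rewrite mem_primes => /and3P[p_pr _ pn].
  rewrite prednK ?prime_gt0 //; apply: pdiv_min_dvd => //; exact: prime_gt1.
apply: (@le_trans _ _ (\sum_(p <- primes n) (p%:R * (p%:R - 1))^-1)).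
  rewrite big_seq [leRHS]big_seq; apply: ler_sum => p.
  rewrite mem_primes => /and3P[/prime_gt1 p1 _ _].
  have : 1 < (p%:R : R) by rewrite ltr1n.
  move: (p%:R : R) => x x1.
  by rewrite lef_pV2 ?posrE; nra.
apply: le_trans (sum_inv_mul_pred_le _ _ pminP) _; rewrite ?primes_uniq //.
  by rewrite -ltnS prednK ?prime_gt0.
case: (pdiv n) pd1 => [//|[//|q]] _ /=.
rewrite ler_pdivlMr ?ltr0n // mulrC ler_pdivrMr ?ltr0n // -natrM ler_nat; lia.
Qed.

(** Two divisors that are not coprime share a prime of [H], such as [pdiv (gcdn e d)]. The pairs
    sharing a given [p] sum to a square, at most [(abundancy H / p)^2]. *)
Lemma sum_noncoprime_le H : (0 < H)%N ->
  \sum_(d <- divisors H | (1 < d)%N)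
    \sum_(e <- divisors H | (1 < e)%N && ~~ coprime e d) (d%:R)^-1 * (e%:R)^-1
  <= 2 * abundancy H ^+ 2 / (pdiv H)%:R.
Proof.
move=> H_gt0.
have V0 (n : nat) : 0 <= (n%:R : R)^-1 by rewrite invr_ge0.
have VV0 (n m : nat) : 0 <= (n%:R : R)^-1 * (m%:R)^-1 by rewrite mulr_ge0.
apply: (@le_trans _ _ (\sum_(p <- primes H)
    (\sum_(d <- divisors H | (p %| d)%N) (d%:R)^-1) ^+ 2)); last first.
  apply: (@le_trans _ _ (\sum_(p <- primes H) abundancy H ^+ 2 * (p%:R ^- 2))).
    rewrite big_seq [leRHS]big_seq; apply: ler_sum => p pH.
    rewrite -exprVn -exprMn mulrC lerXn2r ?nnegrE ?sumr_ge0 ?sum_inv_multiples //.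
    by rewrite mulr_ge0 // (le_trans ler01) // abundancy_ge1.
  rewrite -mulr_sumr.
  have -> x (y : R) : 2 * x / y = x * (2 / y) by rewrite mulrCA mulrA.
  rewrite ler_wpM2l ?sqr_ge0 //.
  exact: sum_inv_sqr_primes_le.
have -> : \sum_(p <- primes H) (\sum_(d <- divisors H | (p %| d)%N) (d%:R)^-1) ^+ 2 =
    \sum_(d <- divisors H) \sum_(e <- divisors H)
       \sum_(p <- primes H | ((p %| d) && (p %| e))%N) ((d%:R)^-1 * (e%:R)^-1 : R).
  under eq_bigr => p _ do rewrite expr2 mulr_suml big_mkcond.
  rewrite exchange_big; apply: eq_bigr => d _ /=.
  under [RHS]eq_bigr => e _ do rewrite big_mkcond.
  rewrite [RHS]exchange_big; apply: eq_bigr => p _ /=.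
  case: (p %| d)%N => /=; last by rewrite big1.
  by rewrite mulr_sumr big_mkcond.
rewrite big_mkcond big_seq [leRHS]big_seq; apply: ler_sum => d dH.
case: ifP => [d1|_]; last by rewrite !sumr_ge0 // => e _; rewrite sumr_ge0.
rewrite big_mkcond big_seq [leRHS]big_seq; apply: ler_sum => e eH.
case: ifP => [/andP[e1 ncop]|_]; last by rewrite sumr_ge0.
have g1 : (1 < gcdn e d)%N.
  rewrite ltn_neqAle eq_sym ncop gcdn_gt0; apply/orP; left.
  exact: ltnW.
have pH : pdiv (gcdn e d) \in primes H.
  rewrite mem_primes pdiv_prime // H_gt0 (dvdn_trans (pdiv_dvd _)) //.
  by rewrite (dvdn_trans (dvdn_gcdl _ _)) // dvdn_divisors.
rewrite (big_rem _ pH) /= !(dvdn_trans (pdiv_dvd _)) ?dvdn_gcdl ?dvdn_gcdr //=.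
by rewrite lerDl sumr_ge0.
Qed.

Lemma delta_avg (C : {fset nat * nat}) (M : nat) : (0 < M)%N ->
  (forall p, p \in C -> (p.1 %| M)%N) ->
  delta R C = avg M (siftedR R (enum_fset C)).
Proof.
move=> M_gt0 CM.
have mem m : (m \in uncovered C) = sifted (enum_fset C) m.
  apply/idP/allP => [|h]; first by rewrite inE => h p /h /eqP.
  by rewrite inE => p /h /eqP.
rewrite /delta (density_periodic _ M_gt0) //; last first.
  by move=> m; rewrite !mem sifted_shift // => p /CM; rewrite dvdzE.
by apply: eq_avg => m; rewrite indicE mem.
Qed.

Lemma delta_ge (H : nat) (C : {fset nat * nat}) : (0 < H)%N ->
  moduli C = divisors_gt1 H ->
  (1 - 2 * abundancy H ^+ 2 * expR (abundancy H) / (pdiv H)%:R) * alpha R C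
    <= delta R C.
Proof.
move=> H_gt0 CH.
set l := enum_fset C.
have permC : perm_eq [seq p.1 | p <- l] [seq d <- divisors H | (1 < d)%N].
  exact/eq_seq_msetP.
have lH : all (fun p => p.1 %| H)%N l.
  apply/allP => p pl.
  have : p.1 \in [seq p.1 | p <- l] by apply: map_f.
  by rewrite (perm_mem permC) mem_filter -dvdn_divisors // => /andP[].
rewrite (delta_avg H_gt0 (allP lH)); apply: le_trans (avg_sifted_ge R H_gt0 lH).
have alphaE : alpha R C = \prod_(d <- divisors H | (1 < d)%N) (1 - (d%:R)^-1).
  rewrite /alpha CH (perm_big _ (perm_eq_seq_mset _)) big_filter //.
have -> : \prod_(p <- l) (1 - (p.1%:R : R)^-1) = alpha R C.
  rewrite alphaE -[RHS]big_filter -(perm_big _ permC) big_map //.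
rewrite mulrBl mul1r lerB //.
have -> : \sum_(p <- l) \sum_(q <- l | ~~ coprime q.1 p.1)
      ((p.1%:R)^-1 * (q.1%:R)^-1 : R) =
   \sum_(d <- divisors H | (1 < d)%N)
    \sum_(e <- divisors H | (1 < e)%N && ~~ coprime e d) (d%:R)^-1 * (e%:R)^-1.
  rewrite -[RHS]big_filter -(perm_big _ permC) big_map; apply: eq_bigr => p _.
  rewrite -[RHS]big_filter_cond -[RHS](perm_big _ permC) big_map //.
apply: le_trans (sum_noncoprime_le H_gt0) _.
(* The additive error becomes a relative one through [1 <= expR (abundancy H) * alpha]. *)
rewrite alphaE [leRHS]mulrAC ler_wpM2r ?invr_ge0 // -[leRHS]mulrA ler_peMr //.
  by rewrite mulr_ge0 // sqr_ge0.
rewrite -(ler_pM2l (expR_gt0 (- abundancy H))) mulr1 mulrA expRN.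
rewrite mulVf ?gt_eqF ?expR_gt0 // mul1r -expRN.
exact: prod_one_sub_inv_ge.
Qed.

End Abundancy.

(** * Chebyshev and Mertens estimates with explicit constants *)

Section Mertens.
Variable R : realType.

Lemma ln_natE (n : nat) : (0 < n)%N ->
  ln n%:R = \sum_(p <- primes n) (logn p n)%:R * ln p%:R :> R.
Proof.
move=> n_gt0; rewrite {1}(prod_prime_decomp n_gt0) prime_decompE big_map /=.
have : {in primes n, forall p, (0 < p)%N}.
  by move=> p; rewrite mem_primes => /and3P[/prime_gt0].
elim: (primes n) => [|p l IH] lP; first by rewrite !big_nil ln1.
have p0 : (0 < p)%N by rewrite lP ?mem_head.
have lP' : {in l, forall q, (0 < q)%N} by move=> q ql; rewrite lP // inE ql orbT.
rewrite !big_cons natrM lnM ?posrE ?ltr0n ?expn_gt0 ?p0 //.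
  by rewrite IH // natrX lnXn ?ltr0n // mulr_natl.
by rewrite big_seq prodn_cond_gt0 // => q /lP' q0; rewrite expn_gt0 q0.
Qed.

Lemma ln_nat_ge0 (n : nat) : 0 <= ln n%:R :> R.
Proof. by case: n => [|n]; [rewrite ln0 | rewrite ln_ge0 // ler1n]. Qed.

Lemma prime_dvd_fact (p n : nat) : prime p -> (p %| n`!)%N = (p <= n)%N.
Proof.
move=> p_pr; apply/idP/idP => [|pn]; last by rewrite dvdn_fact // prime_gt0.
elim: n => [|n IH]; first by rewrite dvdn1 => /eqP p1; rewrite p1 in p_pr.
rewrite factS Euclid_dvdM // => /orP[/dvdn_leq -> //|/IH pn].
exact: leqW.
Qed.

Lemma ln_factE (n : nat) :
  ln n`!%:R = \sum_(1 <= p < n.+1 | prime p) (logn p n`!)%:R * ln p%:R :> R.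
Proof.
rewrite ln_natE ?fact_gt0 // -[RHS]big_filter; apply: perm_big.
apply: uniq_perm; rewrite ?primes_uniq ?filter_uniq ?iota_uniq // => p.
rewrite mem_primes mem_filter fact_gt0 mem_index_iota ltnS.
by case: (boolP (prime p)) => //= p_pr; rewrite prime_dvd_fact // prime_gt0.
Qed.

Lemma sum_ln_primes_le (l : seq nat) (n : nat) : (0 < n)%N -> uniq l ->
  {subset l <= primes n} -> \sum_(p <- l) ln p%:R <= ln n%:R :> R.
Proof.
move=> n_gt0 lu ln; rewrite ln_natE //.
apply: (@le_trans _ _ (\sum_(p <- l) (logn p n)%:R * exp.ln (p%:R : R))).
  rewrite big_seq [leRHS]big_seq; apply: ler_sum => p /ln pn.
  by rewrite ler_peMl ?ln_nat_ge0 // ler1n logn_gt0.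
apply: ler_sum_subset; rewrite ?primes_uniq // => p.
by rewrite mulr_ge0 ?ln_nat_ge0.
Qed.

Lemma bin_le_exp2 (n m : nat) : ('C(n, m) <= 2 ^ n)%N.
Proof.
elim: n m => [|n IH] [|m]; rewrite ?bin0 ?expn_gt0 //.
by rewrite binS expnS mul2n -addnn leq_add.
Qed.

(** With [m = 2^j], every prime in [(m, 2m]] divides [(2m)!] but not [m!], hence divides
    ['C(2m, m) <= 2^(2m)]. Each dyadic block thus adds at most [2^(j+1) ln 2]. *)
Lemma chebyshev_theta_le (j : nat) :
  \sum_(1 <= p < (2 ^ j).+1 | prime p) ln p%:R <= 2 ^+ j.+1 * ln 2 :> R.
Proof.
have ln2_ge0 : 0 <= ln 2 :> R by rewrite ln_ge0 // ler1n.
elim: j => [|j IH].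
  by rewrite big_mkcond big_nat1 /= mulr_ge0.
rewrite (@big_cat_nat _ _ _ (2 ^ j).+1) //=; last by rewrite ltnS leq_pexp2l.
rewrite [2 ^+ j.+2]exprS mulrDl mul1r mulrDl lerD //.
rewrite -big_filter; set m := (2 ^ j)%N.
have m2 : (2 ^ j.+1 = m + m)%N by rewrite expnS mul2n addnn.
apply: le_trans (sum_ln_primes_le (n := 'C(m + m, m)) _ _ _) _.
- by rewrite bin_gt0 leq_addr.
- by rewrite filter_uniq ?iota_uniq.
- move=> p; rewrite mem_filter mem_index_iota m2 ltnS => /and3P[p_pr mp pm].
  rewrite mem_primes p_pr bin_gt0 leq_addr /=.
  have : (p %| (m + m)`!)%N by rewrite prime_dvd_fact.
  rewrite -(bin_fact (leq_addr m m)) addnK !Euclid_dvdM // !prime_dvd_fact //.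
  by rewrite leqNgt mp !orbF.
rewrite -[2 ^+ j.+1]natrX m2 mulr_natl -lnXn ?ltr0n // ler_ln ?posrE ?exprn_gt0 //.
  by rewrite -natrX ler_nat bin_le_exp2.
by rewrite ltr0n bin_gt0 leq_addr.
Qed.

Lemma ln_fact_le (n : nat) : ln n`!%:R <= n%:R * ln n%:R :> R.
Proof.
case: n => [|n]; first by rewrite fact0 ln1 mul0r.
rewrite mulr_natl -lnXn ?ltr0n // ler_ln ?posrE ?exprn_gt0 ?ltr0n ?fact_gt0 //.
rewrite -natrX ler_nat fact_prod -[X in (_ <= _ ^ X)%N]card_ord -prod_nat_const.
rewrite big_add1 big_mkord; exact: leq_prod.
Qed.

Lemma ln_sub_le (x y : R) : 0 < x -> 0 < y -> ln x - ln y <= (x - y) / y.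
Proof.
move=> x0 y0; rewrite -ln_div ?posrE //.
have -> : x / y = 1 + (x - y) / y by field; rewrite gt_eqF.
apply: le_ln1Dx; rewrite ltr_pdivlMr //; lra.
Qed.

(** The induction step amounts to [n (ln (n+1) - ln n) <= 1]. *)
Lemma ln_fact_ge (n : nat) : n%:R * ln n%:R - n%:R <= ln n`!%:R :> R.
Proof.
elim: n => [|n IH]; first by rewrite mul0r subr0 fact0 ln1.
rewrite factS natrM lnM ?posrE ?ltr0n ?fact_gt0 //.
case: n IH => [|n] IH; first by rewrite !mul1r ln1 add0r addr0 oppr_le0.
have := @ln_sub_le n.+2%:R n.+1%:R.
rewrite !ltr0n => /(_ isT isT).
have -> : (n.+2%:R - n.+1%:R) / n.+1%:R = n.+1%:R^-1 :> R.
  by rewrite -[n.+2%:R]natr1 addrAC subrr add0r mul1r.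
rewrite -(ler_pM2l (_ : 0 < (n.+1%:R : R))) ?ltr0n // mulfV ?pnatr_eq0 //.
move: IH; rewrite -[n.+2%:R]natr1; move: (n.+1%:R : R) => x.
lra.
Qed.

(** Legendre's formula with the floors removed, then a geometric series. *)
Lemma logn_fact_le (p n : nat) : prime p ->
  (logn p n`!)%:R <= n%:R * (p%:R - 1)^-1 :> R.
Proof.
move=> p_pr; rewrite logn_fact // natr_sum.
have p1 : 1 < (p%:R : R) by rewrite ltr1n prime_gt1.
have p0 : 0 < (p%:R : R) by apply: lt_trans p1.
apply: (@le_trans _ _ (\sum_(1 <= k < n.+1) n%:R * p%:R ^- k)).
  apply: ler_sum => k _; rewrite ler_pdivlMr ?exprn_gt0 //.
  by rewrite -natrX -natrM ler_nat leq_divM.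
rewrite -mulr_sumr ler_wpM2l //.
suff -> : \sum_(1 <= k < n.+1) p%:R ^- k = (1 - p%:R ^- n) / (p%:R - 1) :> R.
  rewrite ler_piMl ?invr_ge0 ?subr_ge0 ?(ltW p1) //.
elim: n => [|n IH]; first by rewrite big_geq // expr0 invr1 subrr mul0r.
rewrite big_nat_recr //= IH exprS.
have : 0 < (p%:R : R) ^+ n by rewrite exprn_gt0.
move: p0 p1; move: (p%:R ^+ n : R) (p%:R : R) => y x x0 x1 y0.
by field; rewrite !gt_eqF //; lra.
Qed.

(** The first term of Legendre's formula suffices. *)
Lemma logn_fact_ge (p n : nat) : prime p -> (0 < n)%N ->
  n%:R / p%:R - 1 <= (logn p n`!)%:R :> R.
Proof.
move=> p_pr n0; rewrite logn_fact // big_ltn // expn1.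
apply: (@le_trans _ _ (n %/ p)%N%:R); last by rewrite ler_nat leq_addr.
have p0 := prime_gt0 p_pr.
rewrite lerBlDr natr1 ler_pdivrMr ?ltr0n // -natrM ler_nat ltnW //.
by rewrite -ltn_divLR.
Qed.

(* [ln n / (n (n - 1)) <= g (n - 1) - g n] for [g n = (ln n + 2) / n]. *)
Lemma sum_ln_div_le (N : nat) :
  \sum_(2 <= n < N.+1) ln n%:R / (n%:R * (n%:R - 1)) <= 2 :> R.
Proof.
case: N => [|N]; first by rewrite big_geq.
pose g (n : nat) : R := (ln n%:R + 2) / n%:R.
suff : \sum_(2 <= n < N.+2) ln n%:R / (n%:R * (n%:R - 1)) <= 2 - g N.+1.
  move/le_trans; apply; rewrite gerBl /g divr_ge0 // addr_ge0 //.
  exact: ln_nat_ge0.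
elim: N => [|N IH]; first by rewrite big_geq // /g ln1 add0r divr1 subrr.
rewrite big_nat_recr //=; apply: le_trans (lerD IH (lexx _)) _.
suff : ln N.+2%:R / (N.+2%:R * (N.+2%:R - 1)) <= g N.+1 - g N.+2.
  by move: (g _) (g _) (_ / _) => u v w; lra.
have := @ln_sub_le N.+2%:R N.+1%:R; rewrite !ltr0n => /(_ isT isT).
rewrite /g -[N.+2%:R]natr1 addrK.
have : 1 <= (N.+1%:R : R) by rewrite ler1n.
move: (N.+1%:R : R) => x x1; move: (ln (x + 1)) (ln x) => a b.
rewrite [x + 1 - x]addrAC subrr add0r => ab.
have xa : x * (a - b) <= 1 by rewrite mulrC -ler_pdivlMr //; lra.
rewrite -subr_ge0.
(* The numerator is nonnegative: [x (a - b) <= 1] and [1 <= x] give [(x + 1) (a - b) <= 2]. *)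
have -> : (b + 2) / x - (a + 2) / (x + 1) - a / ((x + 1) * x) =
   (2 - (x + 1) * (a - b)) / ((x + 1) * x).
  by field; rewrite !gt_eqF //; lra.
rewrite divr_ge0 //; nra.
Qed.

(** The sum of Mertens' first theorem, equal to [ln n + O(1)]. *)
Definition sum_ln_div (n : nat) : R :=
  \sum_(1 <= p < n.+1 | prime p) ln p%:R / p%:R.

(** Factoring [n!] bounds the sum of [ln p / (p-1)] below by [ln n - 1]; replacing [p - 1] by [p]
    costs at most 2 more. *)
Lemma sum_ln_div_ge (n : nat) : (0 < n)%N -> ln n%:R - 3 <= sum_ln_div n.
Proof.
move=> n_gt0; have n0 : 0 < (n%:R : R) by rewrite ltr0n.
have h1 : ln n%:R - 1 <= \sum_(1 <= p < n.+1 | prime p) ln p%:R / (p%:R - 1) :> R.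
  rewrite -(ler_pM2l n0) mulrBr mulr1; apply: le_trans (ln_fact_ge n) _.
  rewrite ln_factE mulr_sumr; apply: ler_sum => p p_pr.
  by rewrite mulrCA mulrC ler_wpM2l ?ln_nat_ge0 // logn_fact_le.
have h2 : \sum_(1 <= p < n.+1 | prime p) ln p%:R / (p%:R * (p%:R - 1)) <= 2 :> R.
  apply: le_trans (sum_ln_div_le n).
  rewrite big_ltn_cond //= -big_filter; apply: ler_sum_subset.
  - by rewrite filter_uniq ?iota_uniq.
  - by rewrite iota_uniq.
  - by move=> p; rewrite mem_filter => /andP[].
  move=> [|i]; first by rewrite mul0r invr0 mulr0.
  by rewrite divr_ge0 ?ln_nat_ge0 // mulr_ge0 // subr_ge0 ler1n.
have -> : sum_ln_div n = \sum_(1 <= p < n.+1 | prime p) ln p%:R / (p%:R - 1) -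
   \sum_(1 <= p < n.+1 | prime p) ln p%:R / (p%:R * (p%:R - 1)).
  rewrite -sumrB; apply: eq_bigr => p /prime_gt1; rewrite -(ltr1n R).
  by move: (p%:R : R) => x x1; field; rewrite !gt_eqF //; lra.
lra.
Qed.

(** For [n = 2^j], [n] times the sum is at most [ln n!] plus the sum of [ln p] over [p <= n], that
    is, at most [n ln n + 2 n ln 2]. *)
Lemma sum_ln_div_exp2_le (j : nat) : sum_ln_div (2 ^ j) <= (j%:R + 2) * ln 2.
Proof.
set n := (2 ^ j)%N; have n_gt0 : (0 < n)%N by rewrite expn_gt0.
have n0 : 0 < (n%:R : R) by rewrite ltr0n.
have := chebyshev_theta_le j; rewrite -/n.
have : n%:R * sum_ln_div n - \sum_(1 <= p < n.+1 | prime p) ln p%:R <= ln n`!%:R :> R.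
  rewrite ln_factE mulr_sumr -sumrB; apply: ler_sum => p p_pr.
  have -> : n%:R * (ln p%:R / p%:R) - ln p%:R = (n%:R / p%:R - 1) * ln p%:R :> R.
    by ring.
  by rewrite ler_wpM2r ?ln_nat_ge0 // logn_fact_ge.
have := ln_fact_le n.
have lnn : ln n%:R = j%:R * ln 2 :> R by rewrite natrX lnXn // mulr_natl.
rewrite lnn exprS -natrX -/n => h1 h2 h3.
rewrite -(ler_pM2l n0) mulrDl mulrDr.
move: (le_trans h2 h1) h3; move: (\sum_(_ <= _ < _ | _) _) => a; lra.
Qed.

Lemma ln2_ge : 1 / 2 <= ln 2 :> R.
Proof.
have := @ln_sub_le 1 2 ltr01 (ltr0n _ 2); rewrite ln1.
move: (ln 2) => x; lra.
Qed.

Definition sum_inv_primes (m n : nat) : R :=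
  \sum_(m.+1 <= p < n.+1 | prime p) p%:R^-1.

Lemma sum_inv_primes_cat (m n k : nat) : (m <= n)%N -> (n <= k)%N ->
  sum_inv_primes m k = sum_inv_primes m n + sum_inv_primes n k.
Proof. by move=> mn nk; rewrite /sum_inv_primes (@big_cat_nat _ _ _ n.+1). Qed.

(** In this block [ln p <= (j+1) ln 2]. *)
Lemma sum_inv_primes_dyadic_ge (j : nat) :
  (sum_ln_div (2 ^ j.+1) - sum_ln_div (2 ^ j)) / (j.+1%:R * ln 2) <=
    sum_inv_primes (2 ^ j) (2 ^ j.+1).
Proof.
have ln2_gt0 : 0 < ln 2 :> R by have := ln2_ge; move: (ln 2) => x; lra.
rewrite /sum_ln_div (@big_cat_nat _ _ _ (2 ^ j).+1 1 (2 ^ j.+1).+1) //=; last first.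
  by rewrite ltnS leq_pexp2l.
rewrite addrAC subrr add0r ler_pdivrMr ?mulr_gt0 ?ltr0n // /sum_inv_primes.
rewrite mulr_suml big_nat_cond [leRHS]big_nat_cond; apply: ler_sum => p.
move=> /andP[/andP[p0 p2] p_pr]; rewrite mulrC ler_wpM2l ?invr_ge0 //.
rewrite mulr_natl -lnXn // ler_ln ?posrE ?exprn_gt0 ?ltr0n ?prime_gt0 //.
by rewrite -natrX ler_nat -ltnS.
Qed.

(* Abel summation against the bounded error [b] in Mertens' first theorem. *)
Lemma sum_inv_primes_ge (J L : nat) : (J <= L)%N ->
  ln L.+1%:R - ln J.+1%:R - 8 / J.+1%:R <= sum_inv_primes (2 ^ J) (2 ^ L).
Proof.
move=> JL; have ln2_gt0 : 0 < ln 2 :> R by have := ln2_ge; move: (ln 2) => x; lra.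
pose b j : R := sum_ln_div (2 ^ j) / ln 2 - j%:R.
have b_le j : b j <= 2.
  have := sum_ln_div_exp2_le j; rewrite /b -ler_pdivrMr //.
  move: (_ / _) (j%:R) => x y; lra.
(* The error 3 is divided by [ln 2 >= 1/2]. *)
have b_ge j : - 6 <= b j.
  rewrite /b lerBrDr ler_pdivlMr //.
  have := @sum_ln_div_ge (2 ^ j); rewrite expn_gt0 => /(_ isT); apply: le_trans.
  rewrite natrX lnXn // -(mulr_natl (ln 2)); have := ln2_ge; move: (j%:R : R) (ln 2) => y x; lra.
have block j : (1 + b j.+1 - b j) / j.+1%:R <= sum_inv_primes (2 ^ j) (2 ^ j.+1).
  apply: le_trans (sum_inv_primes_dyadic_ge j).
  have j0 : (j.+1%:R : R) != 0 by rewrite pnatr_eq0.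
  have -> : 1 + b j.+1 - b j = (sum_ln_div (2 ^ j.+1) - sum_ln_div (2 ^ j)) / ln 2.
    rewrite /b -(natr1 j); move: (sum_ln_div _) (sum_ln_div _) => u v.
    by field; rewrite gt_eqF.
  by rewrite -mulrA -invfM [ln 2 * _]mulrC.
(* Summation by parts of [block]: boundary terms in [b], and inner terms [b j (1/j - 1/(j+1))] that
   are at least -6 times a telescoping sum. The final 8 is this 6 plus the upper bound 2 for
   [b J]. *)
suff h : ln L.+1%:R - ln J.+1%:R + b L / L.+1%:R - b J / J.+1%:R
    - 6 * (J.+1%:R^-1 - L.+1%:R^-1) <= sum_inv_primes (2 ^ J) (2 ^ L).
  apply: le_trans h; have := b_ge L; have := b_le J.
  have : 0 < (L.+1%:R : R)^-1 by rewrite invr_gt0 ltr0n.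
  have : 0 < (J.+1%:R : R)^-1 by rewrite invr_gt0 ltr0n.
  move: (b L) (b J) (ln _) (ln _) => x y u v; move: (_^-1) (_^-1) => z w; nra.
elim: L JL => [|L IH].
  rewrite leqn0 => /eqP ->; rewrite /sum_inv_primes big_geq //.
  by rewrite !subrr add0r !mulr0 subrr subr0.
rewrite leq_eqVlt => /predU1P[->|JL].
  by rewrite /sum_inv_primes big_geq // !subrr add0r !mulr0 subrr subr0.
rewrite (@sum_inv_primes_cat _ (2 ^ L)) ?leq_pexp2l //.
have := @ln_sub_le L.+2%:R L.+1%:R; rewrite !ltr0n => /(_ isT isT).
have -> : L.+2%:R - L.+1%:R = 1 :> R by rewrite -[L.+2%:R]natr1 addrAC subrr add0r.
have := IH JL; have := block L; have := b_ge L.+1.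
have : (L.+2%:R : R)^-1 <= (L.+1%:R)^-1.
  by rewrite lef_pV2 ?posrE ?ltr0n // ler_nat.
move: (sum_inv_primes _ _) (sum_inv_primes _ _) (b L) (b J) (b L.+1) => s t bL bJ bL'.
move: (ln _) (ln _) (ln _) => x y z; move: (_^-1) (_^-1) (_^-1) => u v w.
nra.
Qed.

End Mertens.

(** * Multiplicativity of [abundancy], and its size at prime powers *)

Section PrimeProducts.
Variable R : realType.

(** Divisors of [a * b] are the products [d * e], where [gcdn] with [a] and with [b] recovers [d]
    and [e]. *)
Lemma abundancyM (a b : nat) : (0 < a)%N -> (0 < b)%N -> coprime a b ->
  abundancy R (a * b) = abundancy R a * abundancy R b.
Proof.
move=> a0 b0 ab; have ab0 : (0 < a * b)%N by rewrite muln_gt0 a0.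
rewrite !abundancyE // mulr_suml.
under [RHS]eq_bigr => d _ do rewrite mulr_sumr.
have /(perm_big _) -> : perm_eq (divisors (a * b))
    [seq (d * e)%N | d <- divisors a, e <- divisors b].
  apply: uniq_perm; rewrite ?divisors_uniq ?allpairs_uniq ?divisors_uniq //.
    have gcdE d e : (d %| a)%N -> (e %| b)%N ->
        gcdn a (d * e) = d /\ gcdn b (d * e) = e.
      move=> da eb; split.
        by rewrite Gauss_gcdl ?(coprime_dvdr eb ab) //; apply/gcdn_idPr.
      rewrite Gauss_gcdr; last by rewrite coprime_sym (coprime_dvdl da ab).
      exact/gcdn_idPr.
    move=> [d e] [d' e'] /allpairsP[[x y] /= [xa yb [-> ->]]].
    move=> /allpairsP[[x' y'] /= [xa' yb' [-> ->]]] /= eq_xy.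
    move: xa yb xa' yb'; rewrite -!dvdn_divisors // => xa yb xa' yb'.
    have [h1 h2] := gcdE _ _ xa yb; have [h1' h2'] := gcdE _ _ xa' yb'.
    by congr (_, _); [rewrite -h1 eq_xy | rewrite -h2 eq_xy].
  move=> d; rewrite -dvdn_divisors //; apply/idP/allpairsP; last first.
    move=> [[x y] /= [xa yb ->]]; move: xa yb; rewrite -!dvdn_divisors //.
    exact: dvdn_mul.
  move=> dab; have g0 : (0 < gcdn d a)%N by rewrite gcdn_gt0 a0 orbT.
  exists (gcdn d a, d %/ gcdn d a)%N; rewrite /= -!dvdn_divisors //; split.
  - exact: dvdn_gcdr.
  - rewrite -(dvdn_pmul2l g0) mulnC divnK ?dvdn_gcdl // muln_gcdl dvdn_gcd dab.
    by rewrite dvdn_mulr.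
  - by rewrite mulnC divnK // dvdn_gcdl.
rewrite big_allpairs_dep; apply: eq_bigr => d _; apply: eq_bigr => e _ /=.
by rewrite natrM invfM.
Qed.

Lemma abundancy_pfactor_ge (p k : nat) : prime p -> (0 < k)%N ->
  1 + (p%:R)^-1 <= abundancy R (p ^ k).
Proof.
move=> p_pr k0; have p1 := prime_gt1 p_pr.
have pk0 : (0 < p ^ k)%N by rewrite expn_gt0 ltnW.
rewrite abundancyE //.
apply: (@le_trans _ _ (\sum_(d <- [:: 1%N; p]) (d%:R)^-1)).
  by rewrite big_cons big_seq1 invr1.
apply: ler_sum_subset => [||d|d]; rewrite ?divisors_uniq ?invr_ge0 //.
  by rewrite /= inE neq_ltn p1.
rewrite !inE -dvdn_divisors // => /orP[]/eqP-> //.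
exact: dvdn_exp.
Qed.

(** A geometric series. The bound is uniform in [k], which leaves [k] free to adjust the size of
    [H]. *)
Lemma abundancy_pfactor_le (p k : nat) : prime p ->
  abundancy R (p ^ k) <= p%:R / (p%:R - 1).
Proof.
move=> p_pr; have p1 := prime_gt1 p_pr.
have pk0 : (0 < p ^ k)%N by rewrite expn_gt0 ltnW.
have x1 : 1 < (p%:R : R) by rewrite ltr1n.
rewrite abundancyE //.
apply: (@le_trans _ _ (\sum_(d <- [seq p ^ i | i <- iota 0 k.+1]%N) (d%:R)^-1)).
  apply: ler_sum_subset => [||d|d]; rewrite ?divisors_uniq ?invr_ge0 //.
    rewrite map_inj_uniq ?iota_uniq // => i j /eqP.
    by rewrite eqn_exp2l // => /eqP.
  rewrite -dvdn_divisors // => /dvdn_pfactor -/(_ p_pr)[i ik ->].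
  by apply: map_f; rewrite mem_iota.
rewrite big_map.
have -> : \sum_(i <- iota 0 k.+1) (p ^ i)%:R^-1 = \sum_(0 <= i < k.+1) (p%:R : R) ^- i.
  by rewrite /index_iota subn0; apply: eq_bigr => i _; rewrite natrX.
move: (p%:R : R) x1 => x x1; have x0 : 0 < x by lra.
have -> : \sum_(0 <= i < k.+1) x ^- i = (x - x ^- k) / (x - 1).
  elim: k {pk0} => [|k IH].
    by rewrite big_nat1 expr0 invr1 divff // gt_eqF //; lra.
  rewrite big_nat_recr //= IH exprS; have : 0 < x ^+ k by rewrite exprn_gt0.
  by move: (x ^+ k) => y y0; field; rewrite !gt_eqF //; lra.
rewrite ler_wpM2r ?invr_ge0 ?subr_ge0 ?(ltW x1) //.
by rewrite gerBl invr_ge0 exprn_ge0 // ltW.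
Qed.

Lemma prod_primes_gt0 (l : seq nat) : all prime l -> (0 < \prod_(p <- l) p)%N.
Proof.
move=> /allP lp; rewrite big_seq prodn_cond_gt0 // => p /lp; exact: prime_gt0.
Qed.

Lemma prime_dvd_prod (l : seq nat) (p : nat) : all prime l -> prime p ->
  (p %| \prod_(q <- l) q)%N -> p \in l.
Proof.
move=> + p_pr; elim: l => [|q l IH] /=; first by rewrite big_nil Euclid_dvd1.
move=> /andP[q_pr lp]; rewrite big_cons Euclid_dvdM // inE.
by rewrite dvdn_prime2 // => /orP[->//|/(IH lp) ->]; rewrite orbT.
Qed.

Lemma abundancy_prod_primes (l : seq nat) (k : nat) : uniq l -> all prime l ->
  abundancy R ((\prod_(p <- l) p) ^ k) = \prod_(p <- l) abundancy R (p ^ k).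
Proof.
elim: l => [_ _|p l IH /= /andP[pl lu] /andP[p_pr lp]].
  by rewrite !big_nil exp1n abundancyE // big_seq1 invr1.
have P0 := prod_primes_gt0 lp.
have cop : coprime (p ^ k) ((\prod_(q <- l) q) ^ k).
  rewrite coprimeXl // coprimeXr // prime_coprime //.
  by apply: contra pl; apply: prime_dvd_prod.
by rewrite !big_cons expnMn abundancyM ?expn_gt0 ?(prime_gt0 p_pr) ?P0 // IH.
Qed.

End PrimeProducts.

(** * Euler products over the primes of an interval *)

Section Construction.
Variable R : realType.

Definition primes_between (m n : nat) : seq nat :=
  [seq p <- index_iota m.+1 n.+1 | prime p].

Lemma mem_primes_between (m n p : nat) :
  (p \in primes_between m n) = [&& prime p, (m < p)%N & (p <= n)%N].
Proof. by rewrite mem_filter mem_index_iota. Qed.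

Lemma primes_between_uniq (m n : nat) : uniq (primes_between m n).
Proof. by rewrite filter_uniq ?iota_uniq. Qed.

Lemma all_primes_between (m n : nat) : all prime (primes_between m n).
Proof. exact: filter_all. Qed.

(** The limit, as [k] grows, of the abundancy of the [k]-th power of the product of these primes. *)
Definition euler_prod (m n : nat) : R :=
  \prod_(p <- primes_between m n) (p%:R / (p%:R - 1)).

Lemma euler_prod_cat (m n k : nat) : (m <= n)%N -> (n <= k)%N ->
  euler_prod m k = euler_prod m n * euler_prod n k.
Proof.
by move=> mn nk; rewrite /euler_prod !big_filter (@big_cat_nat _ _ _ n.+1).
Qed.

Lemma euler_factor_ge1 (p : nat) : prime p -> 1 <= p%:R / (p%:R - 1) :> R.
Proof.
move=> /prime_gt1; rewrite -(ltr1n R) => p1.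
by rewrite ler_pdivlMr ?subr_gt0 // mul1r gerBl.
Qed.

Lemma euler_prod_ge1 (m n : nat) : 1 <= euler_prod m n.
Proof.
rewrite /euler_prod; elim: (primes_between m n) (all_primes_between m n) => [|p l IH] /=.
  by rewrite big_nil.
by move=> /andP[/euler_factor_ge1 p1 /IH l1]; rewrite big_cons mulr_ege1.
Qed.

(** Invert [1 - 1/p <= exp (- 1/p)] factor by factor. *)
Lemma expR_sum_inv_primes_le (m n : nat) :
  expR (sum_inv_primes R m n) <= euler_prod m n.
Proof.
rewrite /sum_inv_primes -big_filter -/(primes_between m n) expR_sum /euler_prod.
rewrite big_seq [leRHS]big_seq; apply: ler_prod => p.
rewrite mem_primes_between => /andP[/prime_gt1]; rewrite -(ltr1n R) => p1 _.
rewrite expR_ge0 /=; have := expR_ge1Dx (- (p%:R : R)^-1).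
rewrite expRN; move: p1 (expR_gt0 (p%:R : R)^-1); move: (p%:R : R) => x x1.
move: (expR _) => e e0.
move=> h.
have -> : x / (x - 1) = (1 - x^-1)^-1 by field; rewrite !gt_eqF //; lra.
have x1' : 0 < 1 - x^-1 by rewrite subr_gt0 invf_lt1 //; lra.
by rewrite -[leLHS]invrK lef_pV2 ?posrE ?invr_gt0.
Qed.

Lemma exists_euler_prod_threshold (a b : nat) (T : R) :
  1 <= T -> T < euler_prod a b ->
  exists m, [/\ (a <= m)%N, (m < b)%N, euler_prod a m <= T & T < euler_prod a m.+1].
Proof.
move=> T1 Tb.
have e_le n : (n <= a)%N -> euler_prod a n = 1.
  by move=> na; rewrite /euler_prod big_filter big_geq.
have ex : exists n, T < euler_prod a n by exists b.
have [n Tn n_min] := ex_minnP ex.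
have an : (a < n)%N by rewrite ltnNge; apply/negP => /e_le h; rewrite h ltNge T1 in Tn.
case: n an Tn n_min => // n an Tn n_min; exists n; split => //.
  exact: n_min.
by rewrite leNgt; apply/negP => /n_min; rewrite ltnn.
Qed.

(** At most one factor is added, namely [(m+1)/m = 1 + 1/m]. *)
Lemma euler_prod_step (a m : nat) : (0 < a)%N -> (a <= m)%N ->
  euler_prod a m.+1 <= euler_prod a m * (1 + (a%:R)^-1).
Proof.
move=> a0 am; rewrite (@euler_prod_cat a m m.+1) // ler_wpM2l //.
  exact: le_trans (euler_prod_ge1 a m).
rewrite /euler_prod big_filter big_mkcond big_nat1.
have aR : 0 < (a%:R : R) by rewrite ltr0n.
have amR : (a%:R : R) <= m%:R by rewrite ler_nat.
case: ifP => _; last by rewrite lerDl invr_ge0.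
rewrite -natr1 addrK; have mR : 0 < (m%:R : R) by apply: lt_le_trans amR.
rewrite mulrDl mul1r divff ?gt_eqF // lerD2l.
by rewrite lef_pV2 ?posrE.
Qed.

(** Weierstrass's product inequality. *)
Lemma prod_one_sub_ge (l : seq nat) (x : nat -> R) :
  (forall p, 0 <= x p <= 1) ->
  1 - \sum_(p <- l) x p <= \prod_(p <- l) (1 - x p) <= 1.
Proof.
move=> x01; elim: l => [|p l /andP[IH1 IH2]]; first by rewrite !big_nil subr0 lexx.
have s0 : 0 <= \sum_(q <- l) x q by apply: sumr_ge0 => q _; case/andP: (x01 q).
have p0 : 0 <= \prod_(q <- l) (1 - x q).
  by apply: prodr_ge0 => q _; rewrite subr_ge0; case/andP: (x01 q).
rewrite !big_cons; move: IH1 IH2 s0 p0; case/andP: (x01 p).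
move: (x p) (\sum_(_ <- _) _) (\prod_(_ <- _) _) => u v w *.
by apply/andP; split; nra.
Qed.

(** Each prime contributes between [1 + 1/p = (1 - p^-2) p/(p-1)] and [p/(p-1)]. As all primes
    exceed [a], the factors [1 - p^-2] multiply to at least [1 - 1/a]. *)
Lemma abundancy_euler_prod (a m k : nat) : (0 < a)%N -> (0 < k)%N ->
  (1 - (a%:R)^-1) * euler_prod a m <=
    abundancy R ((\prod_(p <- primes_between a m) p) ^ k) <= euler_prod a m.
Proof.
move=> a0 k0.
rewrite abundancy_prod_primes ?primes_between_uniq ?all_primes_between //.
have lp := all_primes_between a m; apply/andP; split; last first.
  rewrite /euler_prod big_seq [leRHS]big_seq; apply: ler_prod => p /(allP lp) p_pr.
  rewrite abundancy_pfactor_le // andbT.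
  by apply: le_trans (abundancy_pfactor_ge R p_pr k0); rewrite addr_ge0 ?invr_ge0.
apply: (@le_trans _ _ (\prod_(p <- primes_between a m) (1 + (p%:R)^-1))); last first.
  rewrite big_seq [leRHS]big_seq; apply: ler_prod => p /(allP lp) p_pr.
  by rewrite abundancy_pfactor_ge // addr_ge0 ?invr_ge0.
have -> : \prod_(p <- primes_between a m) (1 + (p%:R)^-1) =
    (\prod_(p <- primes_between a m) (1 - (p%:R ^+ 2)^-1)) * euler_prod a m.
  rewrite /euler_prod -big_split big_seq [RHS]big_seq; apply: eq_bigr => p /(allP lp).
  move=> /prime_gt1; rewrite -(ltr1n R) /=; move: (p%:R : R) => x x1.
  by field; rewrite !gt_eqF //; lra.
rewrite ler_wpM2r //; first exact: le_trans (euler_prod_ge1 a m).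
have h01 (p : nat) : 0 <= ((p%:R : R) ^+ 2)^-1 <= 1.
  case: p => [|p]; first by rewrite expr0n invr0 lexx ler01.
  by rewrite invr_ge0 exprn_ge0 // invf_le1 ?exprn_gt0 ?ltr0n // exprn_ege1 // ler1n.
have /andP[h _] := prod_one_sub_ge (primes_between a m) h01.
apply: le_trans h; rewrite lerD2l lerN2.
have lb : {in primes_between a m, forall p, (a < p)%N}.
  by move=> p; rewrite mem_primes_between => /and3P[].
apply: le_trans (sum_inv_mul_pred_le R a0 (primes_between_uniq a m) lb).
rewrite big_seq [leRHS]big_seq; apply: ler_sum => p /(allP lp) /prime_gt1.
rewrite -(ltr1n R); move: (p%:R : R) => x x1.
by rewrite lef_pV2 ?posrE; nra.
Qed.

Lemma ln_prod_primes_le (a L m : nat) : (m <= 2 ^ L)%N ->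
  ln (\prod_(p <- primes_between a m) p)%:R <= 2 ^+ L.+1 * ln 2 :> R.
Proof.
move=> mL; apply: le_trans (chebyshev_theta_le R L).
have -> : ln (\prod_(p <- primes_between a m) p)%:R =
    \sum_(p <- primes_between a m) ln p%:R :> R.
  elim: (primes_between a m) (all_primes_between a m) => [|p l IH] /=.
    by rewrite !big_nil ln1.
  move=> /andP[p_pr lp]; rewrite !big_cons natrM lnM ?IH //.
    by rewrite posrE ltr0n prime_gt0.
  by rewrite posrE ltr0n prod_primes_gt0.
rewrite -[leRHS]big_filter; apply: ler_sum_subset => [||p|p].
- exact: primes_between_uniq.
- by rewrite filter_uniq ?iota_uniq.
- rewrite mem_primes_between mem_filter mem_index_iota => /and3P[p_pr _ pm].
  by rewrite p_pr prime_gt0 //= ltnS (leq_trans pm).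
- exact: ln_nat_ge0.
Qed.

End Construction.

(** * Numbers with large abundancy and no small prime factor *)

Section AbundantNumbers.
Variable R : realType.

Lemma ln2_le1 : ln 2 <= 1 :> R.
Proof.
have := @ln_sub_le R 2 1 (ltr0n _ 2) ltr01; rewrite ln1.
move: (ln 2) => x; lra.
Qed.

(** The upper bound is the tangent line of [ln] at 16, where [ln 16 = 4 ln 2] lies between 2 and
    4. *)
Lemma ln_natr_bounds (J : nat) : (100 <= J)%N ->
  1 <= ln (J%:R : R) <= J%:R / 16 + 3.
Proof.
move=> J100; have x100 : 100 <= (J%:R : R) by rewrite ler_nat.
have c_ge := ln2_ge R; have c_le := ln2_le1.
have l16 : ln 16 = 4 * ln 2 :> R.
  have -> : 16 = 2 ^+ 4 :> R by ring.
  by rewrite lnXn ?ltr0n // mulr_natl.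
have h16 : ln 16 <= ln (J%:R : R) by rewrite ler_ln ?posrE //; lra.
have := @ln_sub_le R J%:R 16; rewrite ltr0n (ltn_trans _ J100) // ltr0n => /(_ isT isT).
move: h16 c_ge c_le x100; rewrite l16.
move: (ln 2) (ln (J%:R : R)) (J%:R : R) => c l x *.
by apply/andP; split; lra.
Qed.

(** The product is at least [(L+1)/(J+1) * exp (- 8/(J+1))], and [exp (- u) >= 1 - u]; the
    hypothesis clears denominators. *)
Lemma euler_prod_gt (J L : nat) (T : R) : (J <= L)%N ->
  0 <= T -> T * J.+1%:R ^+ 2 < L.+1%:R * (J.+1%:R - 8) ->
  T < euler_prod R (2 ^ J) (2 ^ L).
Proof.
move=> JL T0 h; apply: lt_le_trans (expR_sum_inv_primes_le _ _ _).
have := sum_inv_primes_ge R JL; rewrite -ler_expR; apply: lt_le_trans.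
have y0 : 0 < (J.+1%:R : R) by rewrite ltr0n.
have z0 : 0 < (L.+1%:R : R) by rewrite ltr0n.
rewrite 2!expRD expRN !lnK ?posrE //.
have := expR_ge1Dx (- (8 / J.+1%:R) : R).
move: h y0 z0; move: (J.+1%:R : R) (L.+1%:R : R) => y z h y0 z0.
move: (expR _) => e he.
apply: (@lt_le_trans _ _ (z / y * (1 - 8 / y))); last first.
  by rewrite ler_wpM2l // divr_ge0 // ltW.
have -> : z / y * (1 - 8 / y) = z * (y - 8) / y ^+ 2.
  by field; rewrite gt_eqF.
by rewrite ltr_pdivlMr ?exprn_gt0.
Qed.

Lemma pdiv_prod_primes_gt (a m k : nat) : (0 < k)%N ->
  (1 < \prod_(p <- primes_between a m) p)%N ->
  (a < pdiv ((\prod_(p <- primes_between a m) p) ^ k))%N.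
Proof.
move=> k0 P1; set P := (\prod_(p <- _) p)%N in P1 *.
have H1 : (1 < P ^ k)%N by rewrite -[1%N](exp1n k) ltn_exp2r.
have := pdiv_dvd (P ^ k); have := pdiv_prime H1.
move: (pdiv _) => q q_pr; rewrite Euclid_dvdX // k0 andbT.
move=> /(prime_dvd_prod (all_primes_between a m) q_pr).
by rewrite mem_primes_between => /and3P[].
Qed.

(** The values [k ln P] are spaced by [ln P]. *)
Lemma exists_power_ln (P : nat) (X : R) : 0 < X -> (1 < P)%N ->
  exists2 k, (0 < k)%N & X <= ln (P ^ k)%:R <= X + ln P%:R.
Proof.
move=> X0 P1; have lP : 0 < ln (P%:R : R) by rewrite ln_gt0 // ltr1n.
have := truncn_itv (divr_ge0 (ltW X0) (ltW lP)).
move: (Num.truncn _) => k /andP[k1 k2]; exists k.+1 => //.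
rewrite natrX lnXn ?ltr0n ?(ltnW P1) // -(mulr_natl (ln _)).
move: k1 k2; rewrite ler_pdivlMr // ltr_pdivrMr // -natr1.
move: (k%:R : R) (ln _) => x y *; apply/andP; split; lra.
Qed.

Lemma ln_bounds_exp2 (L : nat) (h : R) : 2 ^+ L <= h <= 3 * 2 ^+ L ->
  L%:R * ln 2 <= ln h <= L%:R * ln 2 + 3.
Proof.
move=> /andP[h_ge h_le].
have X0 : 0 < (2 ^+ L : R) by rewrite exprn_gt0.
have h0 : 0 < h by apply: lt_le_trans h_ge.
have lX : ln (2 ^+ L) = L%:R * ln 2 :> R by rewrite lnXn // mulr_natl.
rewrite -lX ler_ln ?posrE // h_ge /= addrC.
apply: (@le_trans _ _ (ln (3 * 2 ^+ L))); first by rewrite ler_ln ?posrE ?mulr_gt0.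
by rewrite lnM ?posrE // lerD2r ltW // ln_sublinear.
Qed.

(** Meant for [c = ln 2], [x = J], [l = L] and [U = ln ln H]: then [U] is [(c x)^2 + 10 c x] up to a
    constant, between [(c x)^2] and [(c x + 10)^2]. *)
Lemma sqrt_bounds (c x l U : R) : 1 / 2 <= c <= 1 -> 100 <= x ->
  c * x ^+ 2 + 10 * x - 1 <= l <= c * x ^+ 2 + 10 * x ->
  l * c <= U <= l * c + 3 ->
  x <= U /\ c * x <= Num.sqrt U <= c * x + 10.
Proof.
move=> /andP[c_ge c_le] x100 /andP[l_ge l_le] /andP[U_ge U_le].
have cx0 : 0 <= c * x by nra.
have lc_ge : (c * x ^+ 2 + 10 * x - 1) * c <= l * c by rewrite ler_wpM2r //; lra.
have lc_le : l * c <= (c * x ^+ 2 + 10 * x) * c by rewrite ler_wpM2r //; lra.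
have U1 : (c * x) ^+ 2 <= U.
  apply: le_trans U_ge; apply: le_trans lc_ge; rewrite -subr_ge0.
  have -> : (c * x ^+ 2 + 10 * x - 1) * c - (c * x) ^+ 2 = (10 * x - 1) * c by ring.
  by rewrite mulr_ge0 //; lra.
have U2 : U <= (c * x + 10) ^+ 2.
  apply: le_trans U_le _; apply: le_trans (lerD lc_le (lexx _)) _.
  rewrite -subr_ge0.
  have -> : (c * x + 10) ^+ 2 - ((c * x ^+ 2 + 10 * x) * c + 3) = 10 * (c * x) + 97 by ring.
  by lra.
split.
  apply: le_trans U1; apply: (@le_trans _ _ ((1 / 2 * x) ^+ 2)).
    by clear - x100; nra.
  by rewrite lerXn2r ?nnegrE //; [lra | rewrite ler_wpM2r //; lra].
rewrite -{1}(ger0_norm cx0) -sqrtr_sqr ler_wsqrtr //=.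
have h : 0 <= c * x + 10 by lra.
by rewrite -[leRHS](ger0_norm h) -sqrtr_sqr ler_wsqrtr.
Qed.

Lemma exists_abundant (J : nat) : (100 <= J)%N ->
  exists H : nat, [/\ (J < H)%N,
    `|abundancy R H - Num.sqrt (ln (ln H%:R))| <= 15 * ln (ln (ln H%:R)) &
    abundancy R H ^+ 2 * expR (abundancy R H) * Num.sqrt (ln (ln H%:R))
      <= 11 * (pdiv H)%:R].
Proof.
move=> J100; have x100 : 100 <= (J%:R : R) by rewrite ler_nat.
have /andP[lx_ge lx_le] := ln_natr_bounds J100.
have c_ge := ln2_ge R; have c_le := ln2_le1.
pose x : R := J%:R; pose c : R := ln 2; pose lx : R := ln x.
(* [T] is the target abundancy, with [exp T = 2^J / J^3]: the cube of [J] absorbs the square of the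
   abundancy and the square root of [ln ln H]. The slack [10 * x] in [L] lets the Euler product
   exceed [T] yet moves that square root only by a constant. *)
pose T := c * x - 3 * lx; pose L := Num.truncn (c * x ^+ 2 + 10 * x).
rewrite -/x -/lx -/c in x100 lx_ge lx_le c_ge c_le.
have /andP[L_le L_gt] : L%:R <= c * x ^+ 2 + 10 * x < L.+1%:R.
  by apply: truncn_itv; nra.
have L_gt' : c * x ^+ 2 + 10 * x - 1 < L%:R by rewrite ltrBlDr natr1.
have JL : (J <= L)%N by rewrite -(ler_nat R) -/x; nra.
have T_ge : 3 <= T by rewrite /T; nra.
have T_le : T <= c * x - 3 by rewrite /T; lra.
have T_le_x : T <= x by nra.
have y_gt : x < 2 ^+ J by rewrite -natrX ltr_nat ltn_expl.
have TE : T < euler_prod R (2 ^ J) (2 ^ L).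
  apply: euler_prod_gt => //; first lra.
  rewrite -[J.+1%:R]natr1 -/x; set z : R := L.+1%:R in L_gt *.
  have h1 : T * (x + 1) ^+ 2 < c * x * (x + 1) ^+ 2.
    by rewrite ltr_pM2r ?exprn_gt0 //; lra.
  have h2 : c * x * (x + 1) ^+ 2 <= (c * x ^+ 2 + 10 * x) * (x - 7).
    rewrite -subr_ge0.
    have -> : (c * x ^+ 2 + 10 * x) * (x - 7) - c * x * (x + 1) ^+ 2 =
      x * ((10 - 9 * c) * x - 70 - c) by ring.
    by apply: mulr_ge0; nra.
  have h3 : (c * x ^+ 2 + 10 * x) * (x - 7) <= z * (x + 1 - 8).
    have -> : x + 1 - 8 = x - 7 by ring.
    by rewrite ler_wpM2r ?(ltW L_gt) //; lra.
  lra.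
have T1 : 1 <= T by lra.
have [m [am mb fT Tf]] := exists_euler_prod_threshold T1 TE.
have a0 : (0 < 2 ^ J)%N by rewrite expn_gt0.
have := lt_le_trans Tf (euler_prod_step R a0 am).
have f1 := euler_prod_ge1 R (2 ^ J) m.
set f := euler_prod R _ m in fT f1 *.
set y : R := (2 ^ J)%:R; have yE : y = 2 ^+ J by rewrite /y natrX.
rewrite -yE in y_gt; have y0 : 0 < y by lra.
(* Hence stopping before the threshold and using a finite exponent [k] each lose at most 1, so the
   abundancy lies between [T - 2] and [T]. *)
have fy : f / y <= 1 by rewrite ler_pdivrMr // mul1r; lra.
rewrite mulrDr mulr1 => Tf'.
set l := primes_between (2 ^ J) m.
have P1 : (1 < \prod_(p <- l) p)%N.
  have := all_primes_between (2 ^ J) m; rewrite -/l.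
  (* Otherwise [f = 1], and [T < f + f / y <= 2] contradicts [3 <= T]. *)
  have : l != [::].
    apply/eqP => l0; have : f = 1 by rewrite /f /euler_prod -/l l0 big_nil.
    lra.
  case: l => [//|p l'] _ /= /andP[/prime_gt1 p1 /prod_primes_gt0 l'0].
  rewrite big_cons; apply: leq_trans p1 _; exact: leq_pmulr.
have X0 : 0 < (2 ^+ L : R) by rewrite exprn_gt0.
have [k k0 /andP[Xk kX]] := exists_power_ln X0 P1.
have := pdiv_prod_primes_gt k0 P1; have := abundancy_euler_prod R m a0 k0.
rewrite -/l -/f; set H := (_ ^ k)%N in Xk kX *; move=> /andP[s_ge s_le] aH.
have H0 : (0 < H)%N by rewrite expn_gt0 (ltn_trans _ P1).
have lnP := @ln_prod_primes_le R (2 ^ J) L m (ltnW mb).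
have lnH_le : ln H%:R <= 3 * 2 ^+ L :> R.
  apply: le_trans kX _; rewrite -/l in lnP.
  have : 2 ^+ L.+1 * ln 2 <= 2 * 2 ^+ L :> R.
    by rewrite exprS -[leRHS]mulr1 ler_wpM2l // mulr_ge0 ?exprn_ge0.
  move: lnP; clear; move: (2 ^+ L : R) (ln _) (_ * ln 2) => X p q; lra.
pose U : R := ln (ln H%:R).
have U_bd : L%:R * c <= U <= L%:R * c + 3.
  by apply: ln_bounds_exp2; rewrite Xk.
have [||xU /andP[S_ge S_le]] := sqrt_bounds _ x100 _ U_bd.
- by rewrite c_ge.
- by rewrite (ltW L_gt').
have lnU : lx <= ln U.
  by rewrite /lx ler_ln ?posrE //; clear - xU x100; lra.
set s := abundancy R H in s_ge s_le *.
rewrite mulrBl mul1r -[X in _ - X]mulrC in s_ge.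
exists H; rewrite -/s -/U; split.
- apply: leq_trans (ltn_trans (ltn_expl J (ltnSn 1)) aH) _; exact: pdiv_leq.
(* The abundancy minus the square root lies between [- 3 lx - 12] and [- 3 lx], and
   [1 <= lx <= ln U]; this gives 15. *)
- clear - s_le s_ge Tf' fT fy S_ge S_le lnU lx_ge.
  rewrite ler_norml; apply/andP; split; rewrite /T in Tf' fT; lra.
have s0 : 0 <= s by clear - s_ge f1 fy; lra.
have sT : s <= T by clear - s_le fT; lra.
have eT : expR T = y / x ^+ 3.
  have x0 : 0 < x by clear - x100; lra.
  by rewrite /T expRB [c * x]mulrC !expRM_natl /c /lx !lnK ?posrE // yE.
(* Uses [s <= T <= x] and [Num.sqrt U <= x + 10 <= 11 x]; the powers of [x] cancel, leaving [11 y]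
   with [y = 2^J < pdiv H]. *)
apply: (@le_trans _ _ (x ^+ 2 * (y / x ^+ 3) * (11 * x))).
  apply: ler_pM; rewrite ?mulr_ge0 ?sqr_ge0 ?expR_ge0 ?sqrtr_ge0 //.
    apply: ler_pM; rewrite ?sqr_ge0 ?expR_ge0 //.
      by clear - s0 sT T_le_x x100; rewrite lerXn2r ?nnegrE //; lra.
    by rewrite -eT ler_expR.
  apply: le_trans S_le _; clear - c_le x100.
  by apply: (@le_trans _ _ (1 * x + 10)); rewrite ?lerD2r ?ler_wpM2r //; lra.
have -> : x ^+ 2 * (y / x ^+ 3) * (11 * x) = 11 * y.
  by field; rewrite gt_eqF //; clear - x100; lra.
by rewrite ler_wpM2l // ler_nat ltnW.
Qed.

End AbundantNumbers.

(** * Growth of the error scale, positivity of [alpha], and the theorem *)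

Lemma near_sqrt_lnln_ge (R : realType) (A : R) :
  \forall H \near \oo, A <= Num.sqrt (ln (ln (H%:R : R))).
Proof.
near=> H.
have HA : expR (expR (A ^+ 2)) <= H%:R :> R.
  by near: H; exact: nbhs_infty_ger.
have h1 : expR (A ^+ 2) <= ln (H%:R : R).
  by rewrite -[leLHS]expRK ler_ln ?posrE ?expR_gt0 // (lt_le_trans _ HA) ?expR_gt0.
have h2 : A ^+ 2 <= ln (ln (H%:R : R)).
  by rewrite -[leLHS]expRK ler_ln ?posrE ?expR_gt0 // (lt_le_trans _ h1) ?expR_gt0.
by apply: le_trans (ler_norm A) _; rewrite -sqrtr_sqr ler_wsqrtr.
Unshelve. all: by end_near. Qed.

Lemma alpha_gt0 (R : realType) (H : nat) (C : {fset nat * nat}) : (0 < H)%N ->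
  moduli C = divisors_gt1 H -> 0 < alpha R C.
Proof.
move=> H_gt0 CH; rewrite /alpha CH (perm_big _ (perm_eq_seq_mset _)) big_filter.
exact: lt_le_trans (expR_gt0 _) (prod_one_sub_inv_ge R H_gt0).
Qed.

Theorem theorem1 (R : realType) :
  exists S : set nat,
    [/\ infinite_set S,
        (forall H : nat, S H -> (0 < H)%N),
        (exists K : R, forall H : nat, S H ->
           `|(sigma H)%:R / H%:R - Num.sqrt (ln (ln H%:R))|
             <= K * ln (ln (ln H%:R))),
        (exists e : nat -> R,
           e H @[H --> within S \oo] --> (0 : R) /\
           (forall (H : nat) (C : {fset nat * nat}), S H ->
              is_residue_system C -> moduli C = divisors_gt1 H ->
              (1 + e H) * alpha R C <= delta R C))
      & (\forall H \near \oo, S H ->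
           forall C : {fset nat * nat},
             is_residue_system C -> moduli C = divisors_gt1 H ->
             delta R C <> 0)].
Proof.
pose s := abundancy R; pose t (H : nat) : R := Num.sqrt (ln (ln H%:R)).
(* [S] collects all numbers with the properties from [exists_abundant]; the last one says
   [|e H| * t H <= 22], so [e] tends to 0 because [t] tends to infinity. *)
pose S := [set H | [/\ (0 < H)%N, `|s H - t H| <= 15 * ln (ln (ln H%:R)) &
  s H ^+ 2 * expR (s H) * t H <= 11 * (pdiv H)%:R]].
pose e H : R := - (2 * s H ^+ 2 * expR (s H) / (pdiv H)%:R).
have e_small (eps : R) : 0 < eps -> \forall H \near \oo, S H -> `|e H| <= eps.
  move=> eps0; near=> H => -[_ _ h].
  have q0 : 0 < ((pdiv H)%:R : R) by rewrite ltr0n pdiv_gt0.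
  have tA : 22 / eps <= t H by near: H; exact: near_sqrt_lnln_ge.
  have u0 : 0 <= s H ^+ 2 * expR (s H) by rewrite mulr_ge0 ?sqr_ge0 ?expR_ge0.
  rewrite /e -[2 * _ * _]mulrA normrN ger0_norm; last by rewrite divr_ge0 ?mulr_ge0.
  rewrite ler_pdivrMr // -(ler_pM2l (_ : 0 < 11 / eps)) ?divr_gt0 //.
  have -> : 11 / eps * (eps * (pdiv H)%:R) = 11 * (pdiv H)%:R.
    by field; rewrite gt_eqF.
  apply: le_trans h.
  have -> : 11 / eps * (2 * (s H ^+ 2 * expR (s H))) =
    s H ^+ 2 * expR (s H) * (22 / eps) by ring.
  by rewrite ler_wpM2l.
exists S; split.
(* A finite [S] would have a maximum, but [exists_abundant] yields a member above any bound. *)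
- move=> /finite_seqP[l Sl].
  have [H [JH h1 h2]] := @exists_abundant R (maxn 100 (\max_(i <- l) i)) (leq_maxl _ _).
  have : S H by split => //; apply: leq_trans JH.
  rewrite Sl /= => Hl; have : (H <= \max_(i <- l) i)%N by rewrite (leq_bigmax_seq _ Hl).
  by rewrite leqNgt (leq_ltn_trans (leq_maxr _ _) JH).
- by move=> H [].
- by exists 15 => H [].
- exists e; split.
    apply/cvgrPdist_le => eps eps0; have := e_small _ eps0.
    rewrite near_withinE; apply: filterS => H h SH.
    by rewrite sub0r normrN h.
  by move=> H C [H0 _ _] _ CH; apply: delta_ge.
(* Once [|e H| <= 1/2], [delta] is at least half of the positive [alpha]. *)
- have := e_small (1 / 2) (divr_gt0 ltr01 (ltr0n _ 2)).
  apply: filterS => H h SH C _ CH.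
  have H0 : (0 < H)%N by case: SH.
  have := delta_ge R H0 CH; have := h SH; rewrite ler_norml -/s.
  rewrite -/(e H) => /andP[e1 _] dge.
  apply/eqP; rewrite gt_eqF //; apply: lt_le_trans dge.
  by rewrite mulr_gt0 ?(alpha_gt0 _ H0 CH) //; lra.
Unshelve. all: by end_near. Qed.
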